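(* Let $K$ be a field with $\mathrm{char}(K)\neq 2$ and let $E$ be an elliptic curve over $K$. Then $E(K)$ contains a subgroup isomorphic to $\mathbb{Z}/8\mathbb{Z}\oplus\mathbb{Z}/2\mathbb{Z}$ if and only if there exists $c\in K\setminus\{0,\pm1,\pm1\pm\sqrt2,\pm\sqrt{-1}\}$ such that $E$ is isomorphic (over $K$) to the elliptic curve $$\mathcal{E}_{4,c}: y^2=\left[x+\left(\frac{c-\frac1c}{2}\right)^4\right](x+1)x.$$
   Context: The excluded set $\{0,\pm1,\pm1\pm\sqrt2,\pm\sqrt{-1}\}$ means all elements of $K$ equal to $0,\pm1$, or to a square root of $-1$, or to $\pm1\pm s$ with $s^2=2$ (those that exist in $K$). *)

(* Defs.v *)
From HB Require Import structures.
From mathcomp Require Import all_boot all_order all_algebra.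
From mathcomp Require Import ring.

Set Implicit Arguments.
Unset Strict Implicit.
Unset Printing Implicit Defensive.

Import GRing.Theory.
Local Open Scope ring_scope.

(* y^2 + a1 x y + a3 y = x^3 + a2 x^2 + a4 x + a6 *)
Record weierstrass (K : fieldType) := Weierstrass
  { a1 : K; a2 : K; a3 : K; a4 : K; a6 : K }.

Definition discriminant (K : fieldType) (W : weierstrass K) : K :=
  let b2 := a1 W ^+ 2 + 4 * a2 W in
  let b4 := 2 * a4 W + a1 W * a3 W in
  let b6 := a3 W ^+ 2 + 4 * a6 W in
  let b8 := a1 W ^+ 2 * a6 W + 4 * a2 W * a6 W - a1 W * a3 W * a4 W
            + a2 W * a3 W ^+ 2 - a4 W ^+ 2 in
  - b2 ^+ 2 * b8 - 8 * b4 ^+ 3 - 27 * b6 ^+ 2 + 9 * b2 * b4 * b6.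

Record ellipticCurve (K : fieldType) := EllipticCurve
  { curve :> weierstrass K; discriminant_neq0 : discriminant curve != 0 }.

Definition on_affine (K : fieldType) (W : weierstrass K) (x y : K) : bool :=
  y ^+ 2 + a1 W * x * y + a3 W * y
    == x ^+ 3 + a2 W * x ^+ 2 + a4 W * x + a6 W.

(* [None] is the point at infinity. *)
Definition on_curve (K : fieldType) (W : weierstrass K) (P : option (K * K)) :
    bool :=
  if P is Some (x, y) then on_affine W x y else true.

Definition point (K : fieldType) (W : weierstrass K) : Type :=
  {P : option (K * K) | on_curve W P}.

Definition raw_opp (K : fieldType) (W : weierstrass K) (P : option (K * K)) :=
  if P is Some (x, y) then Some (x, - y - a1 W * x - a3 W) else None.

(* Slope of the chord through two affine points, or of the tangent when they
   coincide. *)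
Definition slope (K : fieldType) (W : weierstrass K) (x1 y1 x2 y2 : K) : K :=
  if x1 == x2 then
    (3 * x1 ^+ 2 + 2 * a2 W * x1 + a4 W - a1 W * y1)
      / (2 * y1 + a1 W * x1 + a3 W)
  else (y2 - y1) / (x2 - x1).

Definition raw_add (K : fieldType) (W : weierstrass K)
    (P Q : option (K * K)) : option (K * K) :=
  match P, Q with
  | None, _ => Q
  | _, None => P
  | Some (x1, y1), Some (x2, y2) =>
      if (x1 == x2) && (y1 == - y2 - a1 W * x2 - a3 W) then None else
      let l := slope W x1 y1 x2 y2 in
      let x3 := l ^+ 2 + a1 W * l - a2 W - x1 - x2 in
      raw_opp W (Some (x3, l * (x3 - x1) + y1))
  end.

Lemma raw_oppP (K : fieldType) (W : weierstrass K) (P : option (K * K)) :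
  on_curve W P -> on_curve W (raw_opp W P).
Proof.
case: P => [[x y]|] //= /eqP h; apply/eqP; rewrite -h; ring.
Qed.

Lemma raw_addP (K : fieldType) (W : weierstrass K) (P Q : option (K * K)) :
  on_curve W P -> on_curve W Q -> on_curve W (raw_add W P Q).
Proof.
case: P => [[x1 y1]|] //; case: Q => [[x2 y2]|] // h1 h2.
rewrite /raw_add; case: ifP => // /negbT ne; apply: raw_oppP.
case: W h1 h2 ne => b1 b2 b3 b4 b6; rewrite /on_curve /on_affine /slope /=.
move=> /eqP h1 /eqP h2; case: eqVneq => [e|ne] /= nopp.
- subst x2.
  have [ey|ney] : y2 = y1 \/ y1 = - y2 - b1 * x1 - b3.
  + have : (y2 - y1) * (y1 + y2 + b1 * x1 + b3) = 0.
      transitivity ((y2 ^+ 2 + b1 * x1 * y2 + b3 * y2)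
                    - (y1 ^+ 2 + b1 * x1 * y1 + b3 * y1)); first by ring.
      by rewrite h1 h2 subrr.
    move/eqP; rewrite mulf_eq0 => /orP[]/eqP e0.
      by left; apply/eqP; rewrite -subr_eq0 e0.
    right; transitivity (y1 - (y1 + y2 + b1 * x1 + b3)); last by ring.
    by rewrite e0 subr0.
  + subst y2; have d0 : 2 * y1 + b1 * x1 + b3 != 0.
      apply: contra nopp => /eqP e0; apply/eqP.
      transitivity (y1 - (2 * y1 + b1 * x1 + b3)); last by ring.
      by rewrite e0 subr0.
    set l := _ / _.
    have hl : b4 = l * (2 * y1 + b1 * x1 + b3) + b1 * y1
                   - 3 * x1 ^+ 2 - 2 * b2 * x1.
      by rewrite /l mulfVK //; ring.
    have h6 : b6 = y1 ^+ 2 + b1 * x1 * y1 + b3 * y1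
                   - (x1 ^+ 3 + b2 * x1 ^+ 2 + b4 * x1) by rewrite h1; ring.
    clearbody l; apply/eqP; rewrite h6 hl; ring.
  + by rewrite ney eqxx in nopp.
- have d0 : x2 - x1 != 0 by rewrite subr_eq0 eq_sym.
  set l := _ / _.
  have hy : y2 = l * (x2 - x1) + y1 by rewrite /l mulfVK //; ring.
  have h6 : b6 = y1 ^+ 2 + b1 * x1 * y1 + b3 * y1
                 - (x1 ^+ 3 + b2 * x1 ^+ 2 + b4 * x1) by rewrite h1; ring.
  have h4 : b4 = l * (y2 + y1 + b1 * x2 + b3) + b1 * y1
                 - (x2 ^+ 2 + x2 * x1 + x1 ^+ 2) - b2 * (x2 + x1).
    clearbody l; apply: (mulfI d0).
    transitivity (b4 * x2 + b6 - (b4 * x1 + b6)); first by ring.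
    have -> : b4 * x2 + b6 = y2 ^+ 2 + b1 * x2 * y2 + b3 * y2
                 - (x2 ^+ 3 + b2 * x2 ^+ 2) by rewrite h2; ring.
    by rewrite h6 hy; ring.
  clearbody l; apply/eqP; rewrite h6 h4 hy; ring.
Qed.

Definition ec_zero (K : fieldType) (W : weierstrass K) : point W :=
  exist (fun P => on_curve W P) None isT.

Definition ec_opp (K : fieldType) (W : weierstrass K) (P : point W) : point W :=
  exist (fun P => on_curve W P) _ (raw_oppP (valP P)).

Definition ec_add (K : fieldType) (W : weierstrass K) (P Q : point W) :
    point W :=
  exist (fun P => on_curve W P) _ (raw_addP (valP P) (valP Q)).

Definition ec_subgroup (K : fieldType) (E : ellipticCurve K)
    (H : point E -> Prop) : Prop :=
  [/\ H (ec_zero E),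
      forall P, H P -> H (ec_opp P) &
      forall P Q, H P -> H Q -> H (ec_add P Q)].

Definition subgroup_isomorphic_to (K : fieldType) (E : ellipticCurve K)
    (A : zmodType) (H : point E -> Prop) : Prop :=
  exists f : A -> point E,
    [/\ injective f,
        forall P, H P <-> exists a, f a = P &
        forall a b, f (a + b) = ec_add (f a) (f b)].

Definition has_subgroup_isomorphic_to (K : fieldType) (E : ellipticCurve K)
    (A : zmodType) : Prop :=
  exists H : point E -> Prop, ec_subgroup H /\ subgroup_isomorphic_to A H.

(* The equation obtained from that of [W] by substituting u^2 x + r for x and
   u^3 y + s u^2 x + t for y, then dividing by u^6. *)
Definition change_variables (K : fieldType) (u r s t : K) (W : weierstrass K) :
    weierstrass K :=
  {| a1 := (a1 W + 2 * s) / u;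
     a2 := (a2 W - s * a1 W + 3 * r - s ^+ 2) / u ^+ 2;
     a3 := (a3 W + r * a1 W + 2 * t) / u ^+ 3;
     a4 := (a4 W - s * a3 W + 2 * r * a2 W - (t + r * s) * a1 W
            + 3 * r ^+ 2 - 2 * s * t) / u ^+ 4;
     a6 := (a6 W + r * a4 W + r ^+ 2 * a2 W + r ^+ 3
            - t * a3 W - t ^+ 2 - r * t * a1 W) / u ^+ 6 |}.

Lemma on_change_variables (K : fieldType) (u r s t : K) (W : weierstrass K)
    (x y : K) : u != 0 ->
  on_affine (change_variables u r s t W) x y =
  on_affine W (u ^+ 2 * x + r) (u ^+ 3 * y + s * u ^+ 2 * x + t).
Proof.
move=> u0; rewrite /on_affine -subr_eq0 -[RHS]subr_eq0.
have u6 : u ^+ 6 != 0 by rewrite expf_neq0.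
rewrite -(inj_eq (mulfI u6)) mulr0; congr (_ == 0).
by rewrite /change_variables /=; field.
Qed.

(* Isomorphisms over K of curves in Weierstrass form, preserving the point at
   infinity: these are exactly the admissible changes of variables. *)
Definition isomorphic (K : fieldType) (W W' : weierstrass K) : Prop :=
  exists u r s t : K, u != 0 /\ W' = change_variables u r s t W.

Definition E4 (K : fieldType) (c : K) : weierstrass K :=
  let t := (c - c^-1) / 2 in
  {| a1 := 0; a2 := t ^+ 4 + 1; a3 := 0; a4 := t ^+ 4; a6 := 0 |}.

Lemma on_E4 (K : fieldType) (c x y : K) :
  on_affine (E4 c) x y =
  (y ^+ 2 == (x + ((c - c^-1) / 2) ^+ 4) * (x + 1) * x).
Proof.
rewrite /on_affine /E4 /=; move: (_ / _) => t.
by congr (_ == _); ring.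
Qed.

Definition excluded (K : fieldType) (c : K) : Prop :=
  [\/ c = 0,
      c = 1 \/ c = -1,
      exists s : K, s ^+ 2 = 2 /\
        [\/ c = 1 + s, c = 1 - s, c = -1 + s | c = -1 - s] |
      c ^+ 2 = -1].

(* Main.v *)
Require Import Defs.
From mathcomp Require Import all_boot all_order all_algebra.
From mathcomp Require Import ring.

Set Implicit Arguments.
Unset Strict Implicit.
Unset Printing Implicit Defensive.

Import GRing.Theory.
Local Open Scope ring_scope.

(** A curve with full 2-torsion is [Y^2 = (x - e1) (x - e2) (x - e3)] after
    completing the square, and [x(2P) - e_i] is a square for every point [P].
    If [4P] has abscissa [e1] and [xQ] is that of [Q = 2P], this makes
    [e1 - e2 = a^2], [e1 - e3 = b^2], [xQ - e1 = w^2] and [xQ - e2 = v^2], while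
    [2Q = 4P] gives [w^4 = a^2 b^2]. Hence [a / b = t^2] up to sign with
    [t = w / b], and [(v / w)^2 = t^2 + 1]; this conic is parametrized by
    [c = v / w + t], [c^-1 = v / w - t].

    Conversely, with [s = (c + c^-1) / 2] and [t = (c - c^-1) / 2], the sixteen
    points and the lines through them have coordinates polynomial in [s] and
    [t]. Associativity of the group law is never used: a triple of points has
    sum zero as soon as a line meets the curve in it with multiplicities. *)

(** * Collinear triples of points and the addition law *)

Section ChordTangent.
Variables (K : fieldType) (W : weierstrass K).
Implicit Types P Q R : option (K * K).

(* The line [y = l x + m] cuts out the abscissas [x1], [x2], [x3], counted with
   multiplicity. *)
Definition meets (l m x1 x2 x3 : K) : Prop :=
  [/\ l ^+ 2 + a1 W * l = a2 W + (x1 + x2 + x3),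
      2 * l * m + a1 W * m + a3 W * l = a4 W - (x1 * x2 + x2 * x3 + x3 * x1) &
      m ^+ 2 + a3 W * m = a6 W + x1 * x2 * x3].

(** Membership in the curve is not asked separately: for affine points, [meets] identifies the
    coefficients of a cubic vanishing at the three abscissas. A triple with a point at infinity lies
    on a vertical line, so its other two points are opposite. *)
Definition sum0 P Q R : Prop :=
  match P, Q, R with
  | Some (x1, y1), Some (x2, y2), Some (x3, y3) =>
      exists l m, [/\ y1 = l * x1 + m, y2 = l * x2 + m, y3 = l * x3 + m &
                      meets l m x1 x2 x3]
  | None, _, _ => R = raw_opp W Q
  | _, None, _ => R = raw_opp W P
  | _, _, None => Q = raw_opp W P
  end.

Lemma raw_oppK P : raw_opp W (raw_opp W P) = P.
Proof. by case: P => [[x y]|] //=; congr (Some (_, _)); ring. Qed.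

Lemma sum0_swap P Q R : sum0 P Q R -> sum0 Q P R.
Proof.
case: P Q R => [[x1 y1]|] [[x2 y2]|] [[x3 y3]|] //.
- case=> l [m [-> -> -> [h1 h2 h3]]]; exists l, m; split=> //; split.
  + by rewrite h1; ring.
  + by rewrite h2; ring.
  + by rewrite h3; ring.
- by rewrite /sum0 => ->; rewrite raw_oppK.
Qed.

Lemma sum0_rot P Q R : sum0 P Q R -> sum0 Q R P.
Proof.
case: P Q R => [[x1 y1]|] [[x2 y2]|] [[x3 y3]|] //=.
- case=> l [m [-> -> -> [h1 h2 h3]]]; exists l, m; split=> //; split.
  + by rewrite h1; ring.
  + by rewrite h2; ring.
  + by rewrite h3; ring.
- by case=> -> ->; congr (Some (_, _)); ring.
- by case=> -> ->; congr (Some (_, _)); ring.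
Qed.

Lemma sum0_opp P Q R :
  sum0 P Q R -> sum0 (raw_opp W P) (raw_opp W Q) (raw_opp W R).
Proof.
case: P Q R => [[x1 y1]|] [[x2 y2]|] [[x3 y3]|] //=;
  last by case=> -> ->.
- case=> l [m [-> -> -> [h1 h2 h3]]]; exists (- l - a1 W), (- m - a3 W).
  split; [ring|ring|ring|split].
  + by rewrite -h1; ring.
  + by transitivity (2 * l * m + a1 W * m + a3 W * l); [ring|rewrite h2].
  + by rewrite -h3; ring.
- by case=> -> ->.
- by case=> -> ->.
Qed.

(** If both partial derivatives vanished, they and the equation would express [a3], [a4], [a6]
    through the other data, and the discriminant would then be identically zero. *)
Lemma nonsingular (x y : K) : discriminant W != 0 -> on_affine W x y ->
  2 * y + a1 W * x + a3 W = 0 ->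
  3 * x ^+ 2 + 2 * a2 W * x + a4 W - a1 W * y != 0.
Proof.
move=> + /eqP h d0; apply: contraNneq => n0.
have h3 : a3 W = - (2 * y + a1 W * x).
  by apply/eqP; rewrite -addr_eq0 addrC d0.
have h4 : a4 W = a1 W * y - 3 * x ^+ 2 - 2 * a2 W * x.
  by apply/eqP; rewrite -subr_eq0 -n0; apply/eqP; ring.
have h6 : a6 W = y ^+ 2 + a1 W * x * y + a3 W * y
                 - (x ^+ 3 + a2 W * x ^+ 2 + a4 W * x) by rewrite h; ring.
rewrite /discriminant h6 h4 h3; apply/eqP; ring.
Qed.

(** The slope of the given line is the one [slope] computes. At a double contact its numerator is
    [l] times its denominator, so a zero denominator would make the point singular. *)
Lemma sum0_add P Q R : discriminant W != 0 ->
  sum0 P Q R -> raw_add W P Q = raw_opp W R.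
Proof.
move=> disc; case: P Q R => [[x1 y1]|] [[x2 y2]|] [[x3 y3]|] //.
- case=> l [m [e1 e2 e3 [h1 h2 h3]]]; rewrite /raw_add.
  have f6 : a6 W = m ^+ 2 + a3 W * m - x1 * x2 * x3 by rewrite h3; ring.
  have f4 : a4 W = 2 * l * m + a1 W * m + a3 W * l
                    + (x1 * x2 + x2 * x3 + x3 * x1) by rewrite h2; ring.
  have f2 : a2 W = l ^+ 2 + a1 W * l - (x1 + x2 + x3) by rewrite h1; ring.
  have oc : on_affine W x1 y1.
    by rewrite /on_affine f6 f4 f2 e1; apply/eqP; ring.
  have ns := nonsingular disc oc.
  have sl : x1 = x2 -> 3 * x1 ^+ 2 + 2 * a2 W * x1 + a4 W - a1 W * y1
      = l * (2 * y1 + a1 W * x1 + a3 W).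
    by move=> xx; rewrite f4 f2 e1 -xx; ring.
  have d0 : x1 = x2 -> 2 * y1 + a1 W * x1 + a3 W != 0.
    move=> xx; apply/eqP => d; move: (ns d).
    by rewrite sl // d mulr0 eqxx.
  (* On a non-vertical line equal abscissas force equal points; such a point being its own opposite
     contradicts [d0]. *)
  have -> : (x1 == x2) && (y1 == - y2 - a1 W * x2 - a3 W) = false.
    apply/negbTE/negP => /andP[/eqP xx /eqP yy]; have /negP[] := d0 xx.
    have y12 : y1 = y2 by rewrite e1 e2 xx.
    by apply/eqP; rewrite [in 2 * y1]mulr_natl mulr2n {1}yy -y12 -xx; ring.
  have -> : slope W x1 y1 x2 y2 = l.
    rewrite /slope; case: eqVneq => [xx|ne].
      by rewrite sl // mulfK ?d0.
    have ne' : x2 - x1 != 0 by rewrite subr_eq0 eq_sym.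
    by apply: (mulIf ne'); rewrite mulfVK // e1 e2; ring.
  by rewrite /= f2 e3 e1; congr (Some (_, _)); ring.
- move=> -> /=; rewrite eqxx /=.
  have -> : - (- y1 - a1 W * x1 - a3 W) - a1 W * x1 - a3 W = y1 by ring.
  by rewrite eqxx.
- by move=> ->; rewrite raw_oppK.
- by move=> ->; rewrite raw_oppK.
Qed.

End ChordTangent.

(** * Transport of points along a change of variables *)

Definition change_point (K : fieldType) (u r s t : K) (P : option (K * K)) :=
  if P is Some (x, y) then
    Some (u ^+ 2 * x + r, u ^+ 3 * y + s * u ^+ 2 * x + t)
  else None.

Section ChangePoint.
Variables (K : fieldType) (W : weierstrass K) (u r s t : K).
Hypothesis u0 : u != 0.
Let W' := change_variables u r s t W.
Let phi := change_point u r s t.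

Lemma change_point_opp P : phi (raw_opp W' P) = raw_opp W (phi P).
Proof.
case: P => [[x y]|] //=; congr (Some (_, _)).
by rewrite /W' /change_variables /=; field.
Qed.

Lemma on_curve_change_point P : on_curve W' P -> on_curve W (phi P).
Proof. by case: P => [[x y]|] //=; rewrite on_change_variables. Qed.

Lemma sum0_change_point P Q R :
  sum0 W' P Q R -> sum0 W (phi P) (phi Q) (phi R).
Proof.
case: P Q R => [[x1 y1]|] [[x2 y2]|] [[x3 y3]|]; rewrite /sum0;
  do ?by move/(congr1 phi); rewrite change_point_opp.
case=> l [m [-> -> -> [h1 h2 h3]]].
have f2 : a2 W = u ^+ 2 * (l ^+ 2 + a1 W' * l - (x1 + x2 + x3))
    + s * a1 W - 3 * r + s ^+ 2.
  by rewrite h1 /W' /change_variables /=; field.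
have f4 : a4 W = u ^+ 4 * (2 * l * m + a1 W' * m + a3 W' * l
    + (x1 * x2 + x2 * x3 + x3 * x1)) + s * a3 W - 2 * r * a2 W
    + (t + r * s) * a1 W - 3 * r ^+ 2 + 2 * s * t.
  by rewrite h2 /W' /change_variables /=; field.
have f6 : a6 W = u ^+ 6 * (m ^+ 2 + a3 W' * m - x1 * x2 * x3)
    - (r * a4 W + r ^+ 2 * a2 W + r ^+ 3 - t * a3 W - t ^+ 2 - r * t * a1 W).
  by rewrite h3 /W' /change_variables /=; field.
(* The image of the line, found by eliminating [x] between the two formulas of [change_point]. *)
exists (u * l + s), (u ^+ 3 * m + t - (u * l + s) * r).
split; [ring|ring|ring|split].
- by rewrite f2 /W' /change_variables /=; field.
- by rewrite f4 f2 /W' /change_variables /=; field.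
- by rewrite f6 f4 f2 /W' /change_variables /=; field.
Qed.

End ChangePoint.

(** * The sixteen points *)

Section EightTwo.
Variable K : fieldType.
Implicit Types s t : K.

(** The curve [E4] with [t] as a free parameter, so that the identities below involve no
    division. *)
Definition legendre4 t : weierstrass K :=
  {| a1 := 0; a2 := t ^+ 4 + 1; a3 := 0; a4 := t ^+ 4; a6 := 0 |}.

(* The booleans [(e, d)] stand for the 2-torsion point
   [e T0 + d T1], [T0 = (0, 0)], [T1 = (-1, 0)]; [ptV], [ptA], [ptQ] are its
   translates by [O], by [P = ptA s t false false] and by [2P]. Translating [P]
   by [T0] (resp. [T1]) amounts to changing the sign of [s] (resp. [t]). *)
Definition ptV t (e d : bool) : option (K * K) :=
  match e, d with
  | false, false => None
  | true, false => Some (0, 0)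
  | false, true => Some (-1, 0)
  | true, true => Some (- t ^+ 4, 0)
  end.

Definition ptQ t (e d : bool) : option (K * K) :=
  let y := if d then t ^+ 2 * (t ^+ 2 - 1) else t ^+ 2 * (t ^+ 2 + 1) in
  Some (if d then - t ^+ 2 else t ^+ 2, if e then - y else y).

Definition neg (e : bool) (x : K) := if e then - x else x.

Definition ptA s t (e d : bool) : option (K * K) :=
  let s := neg e s in let t := neg d t in
  Some (t * (t + s) * (1 + s), t * s * (t + s) * (1 + s) * (1 + t)).

Lemma sum0_VV t e d e' d' :
  sum0 (legendre4 t) (ptV t e d) (ptV t e' d') (ptV t (e (+) e') (d (+) d')).
Proof.
case: e d e' d' => [] [] [] [] //=; rewrite ?mul0r ?oppr0 ?addr0 //;
  (exists 0, 0; split; [ring|ring|ring|split=> /=; ring]).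
Qed.

Lemma sum0_VQ t e d e' d' :
  sum0 (legendre4 t) (ptV t e d) (ptQ t e' d')
    (raw_opp (legendre4 t) (ptQ t (e (+) e') (d (+) d'))).
Proof.
(* Slopes of the lines through the 2-torsion point, whose abscissa then fixes [m]. *)
pose l := neg e' (if d then if e then 1 else neg d' (t ^+ 2)
                  else if d' then 1 - t ^+ 2 else t ^+ 2 + 1).
pose m := l * (if d then if e then t ^+ 4 else 1 else 0).
revert l m; case: e d e' d' => [] [] [] [] l m //=;
 (exists l, m; rewrite /m /l; split=> /=; [ring|ring|ring|split=> /=; ring]).
Qed.

Lemma sum0_VA s t e d e' d' : s ^+ 2 = t ^+ 2 + 1 ->
  sum0 (legendre4 t) (ptV t e d) (ptA s t e' d')
    (raw_opp (legendre4 t) (ptA s t (e (+) e') (d (+) d'))).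
Proof.
move=> st; pose s' := neg e' s; pose t' := neg d' t.
pose l := if d then if e then s' + t' else t' * (1 + s') else s' * (1 + t').
pose m := l * (if d then if e then t ^+ 4 else 1 else 0).
revert s' t' l m; case: e d e' d' => [] [] [] [] s' t' l m //=;
  (exists l, m; rewrite /m /l /s' /t'; split=> /=;
   [ring: st|ring: st|ring: st|split=> /=; ring: st]).
Qed.

Lemma sum0_AA s t e d e' d' : s ^+ 2 = t ^+ 2 + 1 ->
  sum0 (legendre4 t) (ptA s t e d) (ptA s t e' d')
    (raw_opp (legendre4 t) (ptQ t (e (+) e') (d (+) d'))).
Proof.
move=> st; pose s' := neg e s; pose t' := neg d t.
(* The first case is the tangent, the others are chords; [m] makes the line pass through the first
   point. *)
pose l := match e (+) e', d (+) d' with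
  | false, false => t' + s' + t' * s'
  | true, false => t' ^+ 2 + t' + 1
  | false, true => t' ^+ 2 + s'
  | true, true => 1 + t' * s'
  end.
pose m := t' * s' * (t' + s') * (1 + s') * (1 + t')
   - l * (t' * (t' + s') * (1 + s')).
revert s' t' l m; case: e d e' d' => [] [] [] [] s' t' l m //=;
  (exists l, m; rewrite /m /l /s' /t'; split=> /=;
   [ring: st|ring: st|ring: st|split=> /=; ring: st]).
Qed.

Lemma opp_ptV t e d : raw_opp (legendre4 t) (ptV t e d) = ptV t e d.
Proof. by case: e d => [] [] //=; congr (Some (_, _)); ring. Qed.

Lemma opp_ptQ t e d : raw_opp (legendre4 t) (ptQ t e d) = ptQ t (~~ e) d.
Proof. by case: e d => [] [] /=; congr (Some (_, _)); ring. Qed.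

(* [k P + e T0 + d T1] for [k < 4]; since [4P = T0], [3P = - (P + T0)]. *)
Definition pt s t (k : nat) (e d : bool) : option (K * K) :=
  match k with
  | 0 => ptV t e d
  | 1 => ptA s t e d
  | 2 => ptQ t e d
  | _ => raw_opp (legendre4 t) (ptA s t (~~ e) d)
  end.

Local Arguments raw_opp : simpl never.
Local Arguments sum0 : simpl never.

(** Addition modulo 4 with a carry: as [4P = T0], an overflow flips [e]. By symmetry ten cases
    remain, each a permuted or negated instance of the four relations above. *)
Lemma sum0_pt s t k e d k' e' d' :
  s ^+ 2 = t ^+ 2 + 1 -> (k < 4)%N -> (k' < 4)%N ->
  sum0 (legendre4 t) (pt s t k e d) (pt s t k' e' d')
    (raw_opp (legendre4 t)
      (pt s t ((k + k') %% 4) (e (+) e' (+) (3 < k + k')%N) (d (+) d'))).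
Proof.
move=> st; wlog le_kk' : k e d k' e' d' / (k <= k')%N.
  move=> H; case/orP: (leq_total k k') => le hk hk'; first exact: H.
  by apply: sum0_swap; rewrite addnC (addbC e) (addbC d); apply: H.
have addKCb x y : x (+) y (+) x = y by rewrite addbAC addbb.
have VA x y := sum0_opp (sum0_VA x y (~~ e') d' st).
have AV := sum0_VA (e (+) ~~ e') (d (+) d') e d st.
have VQ := sum0_VQ t (e (+) ~~ e') (d (+) d') e d.
have AA := sum0_AA e d (e (+) ~~ e') (d (+) d') st.
have NAA := sum0_opp (sum0_AA (~~ e') d' (e (+) ~~ e') (d (+) d') st).
have NAA' := sum0_opp (sum0_AA (~~ e) d (~~ e') d' st).
case: k k' le_kk' => [|[|[|[|//]]]] [|[|[|[|//]]]] //= _ _ _;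
  rewrite ?addbF ?addbT.
- rewrite opp_ptV; exact: sum0_VV.
- exact: sum0_VA.
- exact: sum0_VQ.
- by move: (VA e d); rewrite opp_ptV addbN.
- exact: sum0_AA.
- rewrite raw_oppK; apply/sum0_swap/sum0_rot/sum0_rot; move: AA.
  by rewrite !addKb opp_ptQ negbK addbN.
- apply: sum0_rot; rewrite opp_ptV; move: AV.
  by rewrite 2!addKCb addbN.
- apply: sum0_rot; rewrite opp_ptV; move: VQ.
  by rewrite 2!addKCb opp_ptQ negbK addbN.
- apply/sum0_rot/sum0_rot; move: NAA.
  by rewrite raw_oppK (addbCA (~~ e')) (addbCA d') !addbb !addbF addbN.
- by move: NAA'; rewrite raw_oppK addbN addNb negbK opp_ptQ negbK.
Qed.

Lemma on_curve_pt s t k e d : s ^+ 2 = t ^+ 2 + 1 ->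
  on_curve (legendre4 t) (pt s t k e d).
Proof.
move=> st; have onA x y : on_curve (legendre4 t) (ptA s t x y).
  by apply/eqP; case: x y => [] [] /=; ring: st.
case: k => [|[|[|k]]] //=.
- by case: e d => [] [] //; apply/eqP => /=; ring.
- exact: onA.
- by apply/eqP; case: e d => [] [] /=; ring: st.
- exact: (raw_oppP (onA (~~ e) d)).
Qed.

(** The class of [a] modulo 8 acts as [a P]: its residue modulo 4 is the multiple of [P], its
    quotient the coefficient of [T0]. *)
Definition pt82 s t (g : 'Z_8 * 'Z_2) : option (K * K) :=
  pt s t (g.1 %% 4) (3 < g.1)%N (odd g.2).

Lemma sum0_pt82 s t (g h : 'Z_8 * 'Z_2) : s ^+ 2 = t ^+ 2 + 1 ->
  sum0 (legendre4 t) (pt82 s t g) (pt82 s t h)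
    (raw_opp (legendre4 t) (pt82 s t (g + h))).
Proof.
move=> st; have := @sum0_pt s t (g.1 %% 4) (3 < g.1)%N (odd g.2)
  (h.1 %% 4) (3 < h.1)%N (odd h.2) st (@ltn_pmod _ 4 isT) (@ltn_pmod _ 4 isT).
congr (sum0 _ _ _ (raw_opp _ _)); rewrite /pt82.
case: g h => [[a Ha] [b Hb]] [[a' Ha'] [b' Hb']] /=; congr pt.
- by rewrite modnDm modn_dvdm.
- case: a Ha => [|[|[|[|[|[|[|[|a]]]]]]]] // _;
    by case: a' Ha' => [|[|[|[|[|[|[|[|a']]]]]]]].
- by case: b Hb => [|[|b]] // _; case: b' Hb' => [|[|b']].
Qed.

Lemma pt82_eq_None s t g : pt82 s t g = None -> g = 0.
Proof.
case: g => [[a Ha] [b Hb]]; rewrite /pt82 /=.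
case: b Hb => [|[|//]] Hb;
  case: a Ha => [|[|[|[|[|[|[|[|a]]]]]]]] // Ha;
  by move=> _; congr (_, _); apply: val_inj.
Qed.

End EightTwo.

(** On the conic [(s + t) (s - t) = 1], so [c = s + t] has inverse [s - t] and half the difference
    is [t]. *)
Lemma E4_add (K : fieldType) (s t : K) : (2 : K) != 0 ->
  s ^+ 2 = t ^+ 2 + 1 -> E4 (s + t) = legendre4 t.
Proof.
move=> two_neq0 st; rewrite /E4 /legendre4; set u := _ / 2.
suff -> : u = t by [].
have cV : (s + t) * (s - t) = 1 by ring: st.
have c0 : s + t != 0.
  by apply: contra_eq_neq cV => ->; rewrite mul0r eq_sym oner_neq0.
have c_inv : (s + t)^-1 = s - t by apply: (mulfI c0); rewrite divff.
by rewrite /u c_inv; field.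
Qed.

(** * Descent *)

Section TwoTorsion.
Variables (K : fieldType) (W : weierstrass K).

Lemma double_neq x y z : raw_add W (Some (x, y)) (Some (x, y)) = Some z ->
  2 * y + a1 W * x + a3 W != 0.
Proof.
rewrite /raw_add eqxx /=; case: eqVneq => // ne _; apply: contra ne => /eqP d0.
by apply/eqP/subr0_eq; rewrite -d0; ring.
Qed.

Lemma double_eq_None x y : raw_add W (Some (x, y)) (Some (x, y)) = None ->
  2 * y + a1 W * x + a3 W = 0.
Proof.
rewrite /raw_add eqxx /=; case: eqVneq => // yE _.
by rewrite mulr_natl mulr2n {1}yE; ring.
Qed.

(** If [2P = P] is affine, the equality of abscissas makes the ordinate that of [- P], so [P = - P],
    contrary to [double_neq]. This replaces cancellation in showing that a homomorphism sends 0 to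
    infinity. *)
Lemma double_not_fixed P : raw_add W P P = P -> P = None.
Proof.
case: P => [[x y]|] // h; have /eqP[] := double_neq h.
move: h; rewrite /raw_add eqxx /=; case: eqVneq => // _ [xx yy].
by rewrite mulr_natl mulr2n -{1}yy xx; ring.
Qed.

Hypothesis two_neq0 : (2 : K) != 0.

Variables e1 e2 e3 : K.
Hypothesis b2E : a1 W ^+ 2 + 4 * a2 W = - 4 * (e1 + e2 + e3).
Hypothesis b4E : 2 * a4 W + a1 W * a3 W = 2 * (e1 * e2 + e2 * e3 + e3 * e1).
Hypothesis b6E : a3 W ^+ 2 + 4 * a6 W = - 4 * (e1 * e2 * e3).

Lemma four_neq0 : (4 : K) != 0.
Proof. by rewrite (natrM _ 2 2) mulf_neq0. Qed.

Lemma a2_roots : a2 W = - (e1 + e2 + e3) - a1 W ^+ 2 / 4.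
Proof.
apply: (mulfI four_neq0); transitivity (- 4 * (e1 + e2 + e3) - a1 W ^+ 2).
  by rewrite -b2E; ring.
by field; exact: four_neq0.
Qed.

Lemma a4_roots : a4 W = (e1 * e2 + e2 * e3 + e3 * e1) - a1 W * a3 W / 2.
Proof.
apply: (mulfI two_neq0).
transitivity (2 * (e1 * e2 + e2 * e3 + e3 * e1) - a1 W * a3 W).
  by rewrite -b4E; ring.
by field.
Qed.

Lemma a6_roots : a6 W = - (e1 * e2 * e3) - a3 W ^+ 2 / 4.
Proof.
apply: (mulfI four_neq0); transitivity (- 4 * (e1 * e2 * e3) - a3 W ^+ 2).
  by rewrite -b6E; ring.
by field; exact: four_neq0.
Qed.

Lemma double_sub_root x y xq yq : on_affine W x y ->
  raw_add W (Some (x, y)) (Some (x, y)) = Some (xq, yq) ->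
  xq - e1 = (((x - e1) ^+ 2 - (e1 - e2) * (e1 - e3))
              / (2 * y + a1 W * x + a3 W)) ^+ 2.
Proof.
move=> /eqP h hq; have d0 := double_neq hq.
move: hq; rewrite /raw_add eqxx /=; case: eqVneq => // _ [<- _].
rewrite /slope eqxx.
have hd : (2 * y + a1 W * x + a3 W) ^+ 2 = 4 * (x - e1) * (x - e2) * (x - e3).
  transitivity (4 * (y ^+ 2 + a1 W * x * y + a3 W * y)
    + (a1 W * x + a3 W) ^+ 2); first by ring.
  by rewrite h a2_roots a4_roots a6_roots; field; rewrite four_neq0 two_neq0.
move: d0 hd; set d := 2 * y + a1 W * x + a3 W => d0 hd.
have hy : y = (d - a1 W * x - a3 W) / 2.
  by apply: (mulfI two_neq0); rewrite /d; field.
have d2 : d ^+ 2 != 0 by rewrite expf_neq0.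
clearbody d; apply: (mulIf d2).
rewrite a2_roots a4_roots hy.
(* With [Y = d / 2] and [f] the monic cubic with roots [e1], [e2], [e3], the tangent to [Y^2 = f]
   has slope [f'(x) / d]; denominators are cleared by [d^2 = 4 f(x)]. *)
transitivity ((3 * x ^+ 2 - 2 * (e1 + e2 + e3) * x
    + (e1 * e2 + e2 * e3 + e3 * e1)) ^+ 2 + (e2 + e3 - 2 * x) * d ^+ 2).
  by field; rewrite ?d0 ?four_neq0 ?two_neq0.
transitivity (((x - e1) ^+ 2 - (e1 - e2) * (e1 - e3)) ^+ 2); last by field.
by rewrite hd; ring.
Qed.

Lemma isomorphic_E4 s t b : s ^+ 2 = t ^+ 2 + 1 ->
  e1 - e2 = (t ^+ 2 * b) ^+ 2 -> e1 - e3 = b ^+ 2 -> b != 0 ->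
  isomorphic W (E4 (s + t)).
Proof.
move=> st ha hb b0.
have he2 : e2 = e1 - t ^+ 4 * b ^+ 2.
  by rewrite -[LHS](subKr e1) ha; ring.
have he3 : e3 = e1 - b ^+ 2 by rewrite -[LHS](subKr e1) hb.
rewrite /isomorphic E4_add //.
(* The last two parameters complete the square; the first two send [e1], [e3], [e2] to 0, -1,
   [- t^4]. *)
exists b, e1, (- (a1 W / 2)), (- ((a1 W * e1 + a3 W) / 2)); split=> //.
have := a2_roots; have := a4_roots; have := a6_roots; rewrite he2 he3.
rewrite /change_variables /legendre4 => -> -> ->.
by congr Weierstrass; field; rewrite ?b0 ?four_neq0 ?two_neq0.
Qed.

End TwoTorsion.

Section ThreeRoots.
Variables (K : fieldType) (W : weierstrass K).
Hypothesis two_neq0 : (2 : K) != 0.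

Lemma two_torsion_root x y : on_affine W x y -> 2 * y + a1 W * x + a3 W = 0 ->
  4 * x ^+ 3 + (a1 W ^+ 2 + 4 * a2 W) * x ^+ 2
    + 2 * (2 * a4 W + a1 W * a3 W) * x + (a3 W ^+ 2 + 4 * a6 W) = 0.
Proof.
move=> /eqP h d0; transitivity ((2 * y + a1 W * x + a3 W) ^+ 2); last first.
  by rewrite d0 expr0n.
transitivity (4 * (y ^+ 2 + a1 W * x * y + a3 W * y)
    + (a1 W * x + a3 W) ^+ 2); last by ring.
by rewrite h; ring.
Qed.

(** Divided differences at the distinct roots give a triangular system, solved for [B2], then [B4],
    then [B6]. *)
Lemma cubic_coefficients (B2 B4 B6 e1 e2 e3 : K) :
  e1 != e2 -> e1 != e3 -> e2 != e3 ->
  (forall e, e \in [:: e1; e2; e3] ->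
     4 * e ^+ 3 + B2 * e ^+ 2 + 2 * B4 * e + B6 = 0) ->
  [/\ B2 = - 4 * (e1 + e2 + e3), B4 = 2 * (e1 * e2 + e2 * e3 + e3 * e1) &
      B6 = - 4 * (e1 * e2 * e3)].
Proof.
rewrite -subr_eq0 -[e1 == e3]subr_eq0 -[e2 == e3]subr_eq0 => d12 d13 d23 h.
have {h} [h1 h2 h3] : [/\ 4 * e1 ^+ 3 + B2 * e1 ^+ 2 + 2 * B4 * e1 + B6 = 0,
    4 * e2 ^+ 3 + B2 * e2 ^+ 2 + 2 * B4 * e2 + B6 = 0 &
    4 * e3 ^+ 3 + B2 * e3 ^+ 2 + 2 * B4 * e3 + B6 = 0].
  by split; apply: h; rewrite !inE eqxx ?orbT.
have q12 : 4 * (e1 ^+ 2 + e1 * e2 + e2 ^+ 2) + B2 * (e1 + e2) + 2 * B4 = 0.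
  by apply: (mulfI d12); rewrite mulr0 -(subrr 0) -{1}h1 -h2; ring.
have q13 : 4 * (e1 ^+ 2 + e1 * e3 + e3 ^+ 2) + B2 * (e1 + e3) + 2 * B4 = 0.
  by apply: (mulfI d13); rewrite mulr0 -(subrr 0) -{1}h1 -h3; ring.
have l : 4 * (e1 + e2 + e3) + B2 = 0.
  by apply: (mulfI d23); rewrite mulr0 -(subrr 0) -{1}q12 -q13; ring.
have b2 : B2 = - 4 * (e1 + e2 + e3) by rewrite -[LHS]subr0 -l; ring.
have b4 : B4 = 2 * (e1 * e2 + e2 * e3 + e3 * e1).
  by apply: (mulfI two_neq0); rewrite -[LHS]subr0 -q12 b2; ring.
by split=> //; rewrite -[LHS]subr0 -h1 b2 b4; ring.
Qed.

End ThreeRoots.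

Lemma not_excluded (K : fieldType) (s t : K) : (2 : K) != 0 ->
  s ^+ 2 = t ^+ 2 + 1 -> t != 0 -> t ^+ 4 != 1 -> ~ excluded (s + t).
Proof.
move=> two_neq0 st t0 t1; set c := s + t.
have ct : c * (c - 2 * t) = 1 by rewrite /c; ring: st.
(* The excluded values are those for which [t] is 0, 1, -1 or [c], the last
   with [c ^+ 4 = 1]. *)
have key k : c * (c - 2 * k) = 1 -> t = k.
  move=> ck; have c0 : c != 0.
    by apply: contra_eq_neq ck => ->; rewrite mul0r eq_sym oner_neq0.
  have ckt : c * (c - 2 * k) = c * (c - 2 * t) by rewrite ck.
  apply: (mulfI two_neq0); apply: (mulfI c0).
  by transitivity (c ^+ 2 - c * (c - 2 * t)); [ring|rewrite -{}ckt; ring].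
have key1 k : k ^+ 4 = 1 -> c * (c - 2 * k) = 1 -> False.
  by move=> k4 /key tk; rewrite tk k4 eqxx in t1.
have key0 : c ^+ 2 = 1 -> False.
  by move=> cc; case/eqP: t0; apply: key; rewrite mulr0 subr0.
case=> [c0|[] ce|[r [r2 ce]]|ci].
- by move/eqP: ct; rewrite c0 mul0r eq_sym oner_eq0.
- by apply: key0; rewrite ce expr1n.
- by apply: key0; rewrite ce; ring.
- case: ce => ce; [apply: (key1 1)|apply: (key1 1)|apply: (key1 (-1))
                   |apply: (key1 (-1))]; rewrite ?ce; ring: r2.
- by apply: (key1 c); ring: ci.
Qed.

Lemma descent_parameters (K : fieldType) (a b w v : K) :
  a != 0 -> b != 0 -> a ^+ 2 != b ^+ 2 -> w ^+ 4 = a ^+ 2 * b ^+ 2 ->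
  v ^+ 2 = w ^+ 2 + a ^+ 2 ->
  exists s t, [/\ s ^+ 2 = t ^+ 2 + 1, a ^+ 2 = (t ^+ 2 * b) ^+ 2, t != 0 &
                  t ^+ 4 != 1].
Proof.
move=> a0 b0 ab w4 v2.
have w0 : w != 0.
  apply: contra_eq_neq w4 => ->.
  by rewrite expr0n eq_sym mulf_neq0 ?expf_neq0.
have a2 : a ^+ 2 = ((w / b) ^+ 2 * b) ^+ 2.
  by apply: (mulIf (expf_neq0 2 b0)); rewrite -w4; field.
exists (v / w), (w / b); split=> //; last first.
- by apply: contra ab => /eqP t4; rewrite a2 exprMn -exprM t4 mul1r.
- by rewrite mulf_neq0 ?invr_neq0.
(* Division of [v^2 = w^2 + a^2] by [w^2], where [a^2 / w^2 = w^2 / b^2]. *)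
by rewrite exprMn v2 a2; field; rewrite w0 b0.
Qed.

Lemma E4_of_subgroup (K : fieldType) (E : ellipticCurve K) : (2 : K) != 0 ->
  has_subgroup_isomorphic_to E ('Z_8 * 'Z_2)%type ->
  exists c : K, ~ excluded c /\ isomorphic E (E4 c).
Proof.
move=> two_neq0 [H [_ [f [f_inj _ fD]]]]; pose g a := val (f a).
have gD a b : g (a + b) = raw_add E (g a) (g b) by rewrite /g fD.
have g_inj : injective g by move=> a b /val_inj/f_inj.
have g0 : g 0 = None by apply: (@double_not_fixed _ E); rewrite -gD addr0.
have g_affine a : a != 0 -> {xy : K * K | g a = Some xy}.
  move=> a0; case E1 : (g a) => [xy|]; first by exists xy.
  by case/eqP: a0; apply: g_inj; rewrite g0.
have g_on a x y : g a = Some (x, y) -> on_affine E x y.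
  by move=> ga; have := valP (f a); rewrite -/(g a) ga.
have [[xP yP] gP] := g_affine (1, 0) isT.
have [[xQ yQ] gQ] := g_affine (2, 0) isT.
have [[e1 y1] g1] := g_affine (4, 0) isT.
have [[e2 y2] g2] := g_affine (0, 1) isT.
have [[e3 y3] g3] := g_affine (4, 1) isT.
have PP : raw_add E (Some (xP, yP)) (Some (xP, yP)) = Some (xQ, yQ).
  by rewrite -gP -gD -gQ; congr g; apply/eqP.
have QQ : raw_add E (Some (xQ, yQ)) (Some (xQ, yQ)) = Some (e1, y1).
  by rewrite -gQ -gD -g1; congr g; apply/eqP.
have tors a x y : a + a = 0 -> g a = Some (x, y) ->
    2 * y + a1 E * x + a3 E = 0.
  by move=> a2 ga; apply: double_eq_None; rewrite -ga -gD a2.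
have d1 : 2 * y1 + a1 E * e1 + a3 E = 0 by apply: tors g1; apply/eqP.
have d2 : 2 * y2 + a1 E * e2 + a3 E = 0 by apply: tors g2; apply/eqP.
have d3 : 2 * y3 + a1 E * e3 + a3 E = 0 by apply: tors g3; apply/eqP.
(* A 2-torsion point is determined by its abscissa, as 2 is invertible. *)
have neq a b x y x' y' : a != b -> g a = Some (x, y) -> g b = Some (x', y') ->
    2 * y + a1 E * x + a3 E = 0 -> 2 * y' + a1 E * x' + a3 E = 0 -> x != x'.
  move=> ab ga gb d d'; apply: contra ab => /eqP xx.
  apply/eqP/g_inj; rewrite ga gb xx; congr (Some (_, _)).
  apply: (mulfI two_neq0); apply: (addIr (a1 E * x')); apply: (addIr (a3 E)).
  by rewrite -{1}xx d d'.
have n12 : e1 != e2 by apply: neq g1 g2 d1 d2.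
have n13 : e1 != e3 by apply: neq g1 g3 d1 d3.
have n23 : e2 != e3 by apply: neq g2 g3 d2 d3.
have [|b2E b4E b6E] := cubic_coefficients two_neq0 n12 n13 n23
  (B2 := a1 E ^+ 2 + 4 * a2 E) (B4 := 2 * a4 E + a1 E * a3 E)
  (B6 := a3 E ^+ 2 + 4 * a6 E).
  move=> e; rewrite !inE => /or3P[] /eqP->.
  - exact: two_torsion_root (g_on _ _ _ g1) d1.
  - exact: two_torsion_root (g_on _ _ _ g2) d2.
  - exact: two_torsion_root (g_on _ _ _ g3) d3.
(* Cyclic rotations of the roots, to apply [double_sub_root] to [e2] and [e3] as well. *)
have b2E' : a1 E ^+ 2 + 4 * a2 E = -4 * (e2 + e3 + e1) by rewrite b2E; ring.
have b4E' : 2 * a4 E + a1 E * a3 E = 2 * (e2 * e3 + e3 * e1 + e1 * e2).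
  by rewrite b4E; ring.
have b6E' : a3 E ^+ 2 + 4 * a6 E = -4 * (e2 * e3 * e1) by rewrite b6E; ring.
have b2E'' : a1 E ^+ 2 + 4 * a2 E = -4 * (e3 + e1 + e2) by rewrite b2E; ring.
have b4E'' : 2 * a4 E + a1 E * a3 E = 2 * (e3 * e1 + e1 * e2 + e2 * e3).
  by rewrite b4E; ring.
have b6E'' : a3 E ^+ 2 + 4 * a6 E = -4 * (e3 * e1 * e2) by rewrite b6E; ring.
have oP := g_on _ _ _ gP; have oQ := g_on _ _ _ gQ.
(* Since [2Q] has abscissa [e1], the square given by [double_sub_root] is zero, hence so is its
   numerator. *)
have q2 : (xQ - e1) ^+ 2 = (e1 - e2) * (e1 - e3).
  have := double_sub_root two_neq0 b2E b4E b6E oQ QQ; rewrite subrr => /esym/eqP.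
  rewrite expf_eq0 /= mulf_eq0 invr_eq0 (negbTE (double_neq QQ)) orbF subr_eq0.
  by move/eqP.
have ha := double_sub_root two_neq0 b2E' b4E' b6E' oQ QQ.
have hb := double_sub_root two_neq0 b2E'' b4E'' b6E'' oQ QQ.
have hw := double_sub_root two_neq0 b2E b4E b6E oP PP.
have hv := double_sub_root two_neq0 b2E' b4E' b6E' oP PP.
set a := (_ / _) in ha; set b := (_ / _) in hb.
set w := (_ / _) in hw; set v := (_ / _) in hv; clearbody a b w v.
have a0 : a != 0.
  by apply: contra_neq n12 => z; apply: subr0_eq; rewrite ha z expr0n.
have b0 : b != 0.
  by apply: contra_neq n13 => z; apply: subr0_eq; rewrite hb z expr0n.
have ab : a ^+ 2 != b ^+ 2.
  by rewrite -ha -hb (inj_eq (addrI _)) eqr_opp.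
have w4 : w ^+ 4 = a ^+ 2 * b ^+ 2 by rewrite -ha -hb -q2 hw -exprM.
have v2 : v ^+ 2 = w ^+ 2 + a ^+ 2 by rewrite -hv -hw -ha; ring.
have [s [t [st a2 t0 t4]]] := descent_parameters a0 b0 ab w4 v2.
exists (s + t); split; first exact: not_excluded.
by apply: (isomorphic_E4 two_neq0 b2E b4E b6E st _ hb b0); rewrite ha.
Qed.

(** * From the sixteen points to the subgroup *)

Lemma subgroup_of_legendre4 (K : fieldType) (E : ellipticCurve K)
    (s t u r s' t' : K) : s ^+ 2 = t ^+ 2 + 1 -> u != 0 ->
  legendre4 t = change_variables u r s' t' E ->
  has_subgroup_isomorphic_to E ('Z_8 * 'Z_2)%type.
Proof.
move=> st u0 WE; pose phi g := change_point u r s' t' (pt82 s t g).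
have phi_on g : on_curve E (phi g).
  by apply: on_curve_change_point => //; rewrite -WE; apply: on_curve_pt.
have phiD g h : phi (g + h) = raw_add E (phi g) (phi h).
  have := sum0_pt82 g h st; rewrite WE => /(sum0_change_point u0).
  move/(sum0_add (discriminant_neq0 E)) ->.
  by rewrite change_point_opp // raw_oppK.
pose f g : point E := exist (fun P => on_curve E P) (phi g) (phi_on g).
have fD g h : f (g + h) = ec_add (f g) (f h) by apply/val_inj/phiD.
have fN g : f (- g) = ec_opp (f g).
  have := sum0_pt82 g (- g) st; rewrite subrr WE => /(sum0_change_point u0) h.
  apply: val_inj => /=; move: h; rewrite -/(phi g) -/(phi (- g)).
  by case: (phi g) (phi (- g)) => [[x y]|] [[x' y']|].
exists (fun P => exists g, f g = P); split.
  split.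
  - by exists 0; apply: val_inj.
  - by move=> _ [g <-]; exists (- g).
  - by move=> _ _ [g <-] [h <-]; exists (g + h).
exists f; split=> // g h /(congr1 val) /= gh; apply/eqP; rewrite -subr_eq0.
apply/eqP/(@pt82_eq_None _ s t).
(* Additivity reduces injectivity to the trivial kernel of [pt82]. *)
have : phi (g - h) = None by rewrite phiD gh -phiD subrr.
by rewrite /phi; case: (pt82 _ _ _) => [[]|].
Qed.

Theorem theorem6p5 (K : fieldType) (charK : 2%N \notin [pchar K])
    (E : ellipticCurve K) :
  has_subgroup_isomorphic_to E ('Z_8 * 'Z_2)%type <->
  exists c : K, ~ excluded c /\ isomorphic E (E4 c).
Proof.
have two_neq0 : (2 : K) != 0 by apply: contra charK => two0; rewrite inE.
split; first exact: E4_of_subgroup.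
case=> c [exc [u [r [s' [t' [u0 WE]]]]]].
have c0 : c != 0 by apply/eqP => c0; apply: exc; apply: Or41.
(* For this value of [t], [E4 c] unfolds to [legendre4 t], so [WE] fits as it stands. *)
apply: (@subgroup_of_legendre4 _ _ ((c + c^-1) / 2) ((c - c^-1) / 2)) u0 WE.
by field; rewrite c0 two_neq0.
Qed.
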